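(* For any fixed integers $d,k\ge 1$ there exists $\varepsilon_{d,k}>0$ such that for every $\varepsilon$ with $0<\varepsilon<\varepsilon_{d,k}$ the following two statements hold. (A) The maximum cardinality of a $(k,\varepsilon)$-distance set in $\mathbb{R}^d$ is $$m(d,k,\varepsilon)=(d+1)^k.$$ (B) For any set $P\subset\mathbb{R}^d$ of $n\ge 1$ points, and for any $t_1,\ldots,t_k>0$, the number of unordered pairs of distinct points of $P$ whose distance belongs to the set $\bigcup_{j=1}^k[t_j,t_j(1+\varepsilon)]$ is at most the Turán number $T\bigl((d+1)^k+1,\,n\bigr)$. Moreover, the upper bound in (B) cannot be reduced to $T\bigl((d+1)^k+1,n\bigr)-1$, for any $d,k,n$ and any $\varepsilon>0$: for all integers $d,k,n\ge 1$ and every $\varepsilon>0$ there exist an $n$-element set $P\subset\mathbb{R}^d$ and $t_1,\ldots,t_k>0$ such that the number of unordered pairs of distinct points of $P$ whose distance belongs to $\bigcup_{j=1}^k[t_j,t_j(1+\varepsilon)]$ is at least $T\bigl((d+1)^k+1,n\bigr)$.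
   Context: For integers $r,n\ge 1$, the Turán number $T(r,n)$ is the maximum number of edges of a (simple) graph on $n$ vertices that contains no complete subgraph $K_r$ on $r$ vertices. For $\varepsilon\ge 0$ and integers $d,k\ge 1$, a finite subset of $\mathbb{R}^d$ is called a $(k,\varepsilon)$-distance set if there exist $t_1,\ldots,t_k>0$ such that all (Euclidean) distances between pairs of distinct points of the set lie in the union of the $k$ intervals $[t_1,t_1(1+\varepsilon)],\ldots,[t_k,t_k(1+\varepsilon)]$. The maximum cardinality of a $(k,\varepsilon)$-distance set in $\mathbb{R}^d$ is denoted by $m(d,k,\varepsilon)$ (it is finite). The point sets here are not required to have minimum distance at least $1$. *)

(* Defs.v *)
From mathcomp Require Import all_boot all_order all_algebra.
From mathcomp Require Import finmap reals.

Set Implicit Arguments.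
Unset Strict Implicit.
Unset Printing Implicit Defensive.

Import Order.TTheory GRing.Theory Num.Theory.
Local Open Scope ring_scope.

(* A simple graph on the vertex set V is given by its set of edges, each edge
   being a two-element set of vertices. *)
Definition simple_graph (V : finType) (E : {set {set V}}) : bool :=
  [forall e in E, #|e| == 2%N].

Definition is_clique (V : finType) (E : {set {set V}}) (S : {set V}) : bool :=
  [forall x in S, forall y in S, (x != y) ==> ([set x; y] \in E)].

Definition has_complete_subgraph (V : finType) (r : nat) (E : {set {set V}}) :
    bool :=
  [exists S : {set V}, (#|S| == r) && is_clique E S].

(* The edgeless graph qualifies when r >= 2. For r = 1 and n >= 1 no graph
   qualifies, and the maximum over the empty family is 0. *)
Definition turan_number (r n : nat) : nat :=
  \max_(E : {set {set 'I_n}} |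
        simple_graph E && ~~ has_complete_subgraph r E) #|E|.

(* The norm that the library puts on 'rV[R]_d is the sup norm, hence an explicit
   Euclidean distance. *)
Definition edist (R : realType) (d : nat) (x y : 'rV[R]_d) : R :=
  Num.sqrt (\sum_(i < d) (x 0 i - y 0 i) ^+ 2).

Definition in_intervals (R : realType) (k : nat) (t : 'I_k -> R) (eps s : R) :
    bool :=
  [exists j, s \in `[t j, t j * (1 + eps)]].

Definition is_dist_set (R : realType) (d k : nat) (eps : R)
    (P : {fset 'rV[R]_d}) : Prop :=
  exists t : 'I_k -> R,
    (forall j, 0 < t j) /\
    (forall p q, p \in P -> q \in P -> p != q ->
       in_intervals t eps (edist p q)).

Definition is_maximum (A : nat -> Prop) (m : nat) : Prop :=
  A m /\ (forall a, A a -> (a <= m)%N).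

(* "m(d, k, eps) = m": a relation, so that the finiteness of the maximum is part
   of the assertion. *)
Definition max_dist_set_card (R : realType) (d k : nat) (eps : R) (m : nat) :
    Prop :=
  is_maximum
    (fun a => exists P : {fset 'rV[R]_d}, is_dist_set k eps P /\ #|` P| = a) m.

(* The unordered pairs of distinct points of P, as two-element sets, whose
   distance lies in the union of the intervals; P is used as a finite type. *)
Definition near_pairs (R : realType) (d k : nat) (P : {fset 'rV[R]_d})
    (t : 'I_k -> R) (eps : R) : {set {set P}} :=
  [set [set pq.1; pq.2] | pq : P * P &
     (pq.1 != pq.2) && in_intervals t eps (edist (val pq.1) (val pq.2))].

(* Main.v *)
Require Import Defs.
From mathcomp Require Import all_boot all_order all_algebra.
From mathcomp Require Import finmap reals.
From mathcomp Require Import ring lra zify.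

Set Implicit Arguments.
Unset Strict Implicit.
Unset Printing Implicit Defensive.

Import Order.TTheory GRing.Theory Num.Theory.
Local Open Scope ring_scope.

(** The upper bounds rest on one fact: for small [eps], a set whose distances lie
    in [k] intervals [t, t (1 + eps)] has at most [(d + 1) ^ k] points. The graph
    of near pairs then has no clique on [(d + 1) ^ k + 1] vertices, and the bound
    by the Turan number is its definition.

    When the lengths [t] are within a fixed ratio of each other, the fact follows
    from linear algebra. Put [F a b = \prod_t (t ^ 2 - |a - b| ^ 2)]. On the
    diagonal [F] is [D = \prod_t t ^ 2]; off the diagonal it is
    tiny compared to [D], as one factor almost vanishes. With more than
    [(d + 1) ^ k] points some nonzero weight vector [u] is orthogonal to all
    products of [k] affine coordinates. As [F] has total degree [2 k], each of its
    monomials has degree at most [k] in [a] or in [b], so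
    [\sum_a \sum_b u a * u b * F a b = 0] ([annihilated_form]), against the
    dominance of the diagonal ([polynomial_method]).

    In general the [t] may spread over many scales. If two lengths are far apart,
    some scale [theta] separates the lengths by a factor 8 ([exists_gap]), and
    being closer than [theta] is an equivalence relation on the points. With [j]
    lengths above [theta], induction bounds the number of classes by
    [(d + 1) ^ j] and each class by [(d + 1) ^ (k - j)] ([card_near_set]).

    For the constructions, replace each point of a regular simplex by a tiny copy
    of a simplex, [k] levels deep, and each innermost point by a minute cluster
    ([nested_simplices]). This realizes every colouring of [n] points with
    [(d + 1) ^ k] colours: points of different colours are at a near distance.
    That such complete multipartite graphs reach the Turan number is Turan's
    theorem, in the form that the edges of a graph without a complete subgraph
    on [r + 1] vertices are at most as many as the bichromatic pairs of some
    [r]-colouring ([turan_colouring]). *)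

(** * The polynomial method for nearly equal distances *)

(** Squared distances are polynomials in the coordinates, which the linear algebra
    below needs; they also avoid the Cauchy-Schwarz inequality. *)
Definition sqdist (R : realType) (d : nat) (x y : 'rV[R]_d) : R :=
  \sum_(i < d) (x 0 i - y 0 i) ^+ 2.

(** The constant 1 is coordinate 0, so that products of exactly [s] affine
    coordinates span all polynomials of degree at most [s]. There are
    [(d + 1) ^ s] of them, counted with repetition: an overcount of the
    dimension that suffices here. *)
Definition affine_coord (R : realType) (d : nat) (x : 'rV[R]_d) (i : 'I_d.+1) :
    R :=
  if unlift ord0 i is Some j then x 0 j else 1.

Definition monomial (R : realType) (d : nat) (l : seq 'I_d.+1) (x : 'rV[R]_d) :
    R :=
  \prod_(i <- l) affine_coord x i.

Section PolynomialMethod.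
Variables (R : realType) (d : nat).
Implicit Types (x y : 'rV[R]_d) (l : seq 'I_d.+1) (ts : seq R).

Lemma affine_coord0 x : affine_coord x ord0 = 1.
Proof. by rewrite /affine_coord unlift_none. Qed.

Lemma affine_coordS x (j : 'I_d) : affine_coord x (lift ord0 j) = x 0 j.
Proof. by rewrite /affine_coord liftK. Qed.

Lemma sqdist_ge0 x y : 0 <= sqdist x y.
Proof. by apply: sumr_ge0 => i _; exact: sqr_ge0. Qed.

Lemma sqdistxx x : sqdist x x = 0.
Proof. by apply: big1 => i _; rewrite subrr expr0n. Qed.

Lemma sqdistC x y : sqdist x y = sqdist y x.
Proof. by rewrite /sqdist; apply: eq_bigr => i _; ring. Qed.

Lemma sqdist_weak_triangle x y z :
  sqdist x z <= 2 * (sqdist x y + sqdist y z).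
Proof.
rewrite /sqdist -big_split mulr_sumr; apply: ler_sum => i _ /=.
have := sqr_ge0 ((x 0 i - y 0 i) - (y 0 i - z 0 i)).
nra.
Qed.

Lemma sqr_edist x y : edist x y ^+ 2 = sqdist x y.
Proof. by rewrite sqr_sqrtr // sqdist_ge0. Qed.

(** The matrix of the values of the [(d + 1) ^ s] monomials at [N] points has fewer
    columns than rows, hence a left kernel. *)
Lemma exists_annihilator N s (p : 'I_N -> 'rV[R]_d) :
  (d.+1 ^ s < N)%N ->
  exists2 u : 'I_N -> R, (exists a, u a != 0) &
    forall l, (size l <= s)%N -> \sum_a u a * monomial l (p a) = 0.
Proof.
move=> ltN; pose T := {: s.-tuple 'I_d.+1}.
pose A := \matrix_(a < N, c < #|T|) monomial (enum_val c) (p a).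
have : kermx A != 0.
  rewrite -mxrank_eq0 mxrank_ker subn_eq0 -ltnNge.
  by rewrite (leq_ltn_trans (rank_leq_col A)) // card_tuple card_ord.
case/rowV0Pn => v /sub_kermxP vA0 /eqP v0.
exists (fun a => v 0 a).
  apply/existsP; apply: contra_notT v0 => /existsPn v0.
  by apply/rowP => a; rewrite mxE; apply/eqP; have := v0 a; rewrite negbK.
move=> l le_l.
(* Coordinate 0 being 1, shorter monomials are padded to length [s]. *)
have szl : size (nseq (s - size l) ord0 ++ l) == s.
  by rewrite size_cat size_nseq subnK.
have := congr1 (fun B : 'M_(1, _) => B 0 (enum_rank (Tuple szl : T))) vA0.
rewrite !mxE; apply: etrans; apply: eq_bigr => a _; rewrite mxE enum_rankK /=.
by rewrite /monomial big_cat big_nseq iter_mulr affine_coord0 expr1n /= !mul1r.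
Qed.

(** The accumulators [l1] and [l2] make the induction on [ts] go through: expanding
    one factor [t ^ 2 - |a - b| ^ 2] adds two to the total degree, spread over
    the two monomials. At the end one of them has degree at most [s], and
    summing over its variable gives 0. *)
Lemma annihilated_form N s (p : 'I_N -> 'rV[R]_d) (u : 'I_N -> R) ts l1 l2 :
  (forall l, (size l <= s)%N -> \sum_a u a * monomial l (p a) = 0) ->
  (size l1 + size l2 + (size ts).*2 <= s.*2)%N ->
  \sum_a \sum_b (u a * monomial l1 (p a)) * (u b * monomial l2 (p b))
    * \prod_(t <- ts) (t ^+ 2 - sqdist (p a) (p b)) = 0.
Proof.
move=> u_ann; elim: ts l1 l2 => [|t ts IH] l1 l2 /= le_s.
  rewrite (_ : \sum_a _ = (\sum_a u a * monomial l1 (p a)) *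
                          (\sum_b u b * monomial l2 (p b))); last first.
    rewrite mulr_suml; apply: eq_bigr => a _; rewrite mulr_sumr.
    by apply: eq_bigr => b _; rewrite big_nil mulr1.
  have [le1|lt1] := leqP (size l1) s; first by rewrite u_ann // mul0r.
  by rewrite [X in _ * X]u_ann ?mulr0 //; lia.
pose G l1 l2 a b := (u a * monomial l1 (p a)) * (u b * monomial l2 (p b))
    * \prod_(t <- ts) (t ^+ 2 - sqdist (p a) (p b)).
have G0 l l' : (size l + size l' + (size ts).*2 <= s.*2)%N ->
    \sum_a \sum_b G l l' a b = 0 by exact: IH.
have monoS j l x : monomial (lift ord0 j :: l) x = x 0 j * monomial l x.
  by rewrite /monomial big_cons affine_coordS.
have GSl j l l' a b : G (lift ord0 j :: l) l' a b = p a 0 j * G l l' a b.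
  by rewrite /G monoS; ring.
have GSr j l l' a b : G l (lift ord0 j :: l') a b = p b 0 j * G l l' a b.
  by rewrite /G monoS; ring.
transitivity (\sum_a \sum_b (t ^+ 2 * G l1 l2 a b + \sum_(i < d)
   (2 * G (lift ord0 i :: l1) (lift ord0 i :: l2) a b
    - G [:: lift ord0 i, lift ord0 i & l1] l2 a b
    - G l1 [:: lift ord0 i, lift ord0 i & l2] a b))).
  apply: eq_bigr => a _; apply: eq_bigr => b _.
  under [X in _ = _ + X]eq_bigr do rewrite !GSl !GSr.
  rewrite big_cons mulrCA -/(G l1 l2 a b) mulrBl; congr (_ + _).
  by rewrite /sqdist mulr_suml -sumrN; apply: eq_bigr => i _; ring.
under eq_bigr do rewrite big_split /= -mulr_sumr exchange_big /=.
rewrite big_split /= -mulr_sumr G0; last by lia.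
rewrite mulr0 add0r exchange_big /=; apply: big1 => i _.
under eq_bigr do rewrite !sumrB -mulr_sumr.
rewrite !sumrB -mulr_sumr !G0 ?mulr0 ?subr0 //=; lia.
Qed.

(** If [N * |F a b| < D] for all [a != b], the quadratic form of [F] would be positive
    definite: by [|u a * u b| <= (u a ^ 2 + u b ^ 2) / 2], the off-diagonal part
    is at most [D * \sum_a u a ^ 2] in absolute value, and strictly less. This
    contradicts [annihilated_form]. *)
Lemma polynomial_method N (p : 'I_N -> 'rV[R]_d) ts :
  {in ts, forall t, 0 < t} -> (d.+1 ^ size ts < N)%N ->
  exists a b, a != b /\
    \prod_(t <- ts) t ^+ 2
      <= N%:R * `|\prod_(t <- ts) (t ^+ 2 - sqdist (p a) (p b))|.
Proof.
move=> ts_gt0 /(exists_annihilator p) [u [a0 ua0] u_ann].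
set D := \prod_(t <- ts) t ^+ 2.
pose F a b := \prod_(t <- ts) (t ^+ 2 - sqdist (p a) (p b)).
have FD a : F a a = D by apply: eq_bigr => t _; rewrite sqdistxx subr0.
have N0 : 0 < N%:R :> R by rewrite ltr0n; case: (N) a0 {ua0} => [[]|].
have D0 : 0 < D.
  by rewrite /D big_seq; apply: prodr_gt0 => t /ts_gt0 t0; exact: exprn_gt0.
suff /existsP[a /existsP[b /andP[ab leD]]] :
    [exists a, exists b, (a != b) && (D <= N%:R * `|F a b|)].
  by exists a, b.
apply: contraT => /existsPn small.
have {}small a b : a != b -> N%:R * `|F a b| < D.
  by move=> ab; have /existsPn/(_ b) := small a; rewrite ab /= -ltNge.
have form0 : \sum_a \sum_b u a * u b * F a b = 0.
  apply: etrans (@annihilated_form N _ p u ts [::] [::] u_ann (leqnn _)).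
  apply: eq_bigr => a _; apply: eq_bigr => b _.
  by rewrite /monomial !big_nil !mulr1.
(* The second summand keeps the surplus [D / N * u a ^ 2] of the diagonal, which
   makes the final inequality strict. *)
have lower a b : u a * u b * F a b >= - (D / N%:R) * (u a ^+ 2 + u b ^+ 2) / 2
    + (if a == b then D * (u a) ^+ 2 + D / N%:R * (u a) ^+ 2 else 0).
  have [<-|/small] := eqVneq a b; first by rewrite FD; nra.
  rewrite mulrC -ltr_pdivlMr // => /ltW Fs.
  have := ler_norm (- (u a * u b * F a b)).
  rewrite normrN !normrM addr0.
  have := sqr_ge0 (`|u a| - `|u b|); rewrite -[u a ^+ 2]real_normK ?num_real //.
  rewrite -[u b ^+ 2]real_normK ?num_real //.
  have := normr_ge0 (u a); have := normr_ge0 (u b); have := normr_ge0 (F a b).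
  set x := `|u a|; set y := `|u b|; set f := `|F a b|; set q := D / _ in Fs *.
  move=> f0 y0 x0 xy0.
  have : f * (x * y) <= q * (x * y) by rewrite ler_wpM2r // mulr_ge0.
  by have := le_trans f0 Fs; nra.
have : \sum_a \sum_b u a * u b * F a b >= D / N%:R * \sum_a u a ^+ 2.
  apply: le_trans (ler_sum _ (fun a _ => ler_sum _ (fun b _ => lower a b))).
  rewrite le_eqVlt; apply/orP; left; apply/eqP/esym.
  set S := \sum_a u a ^+ 2.
  transitivity (\sum_a (- (D / N%:R) * (N%:R * u a ^+ 2 + S) / 2
      + (D * u a ^+ 2 + D / N%:R * u a ^+ 2))).
    apply: eq_bigr => a _; rewrite big_split /= -big_mkcond /=; congr (_ + _).
      rewrite -mulr_suml -mulr_sumr big_split /= sumr_const card_ord.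
      by rewrite -[u a ^+ 2 *+ _]mulr_natl.
    by rewrite (big_pred1 a) // => b; exact: eq_sym.
  rewrite big_split /= -mulr_suml -mulr_sumr !big_split /= -!mulr_sumr.
  rewrite sumr_const card_ord -/S -[S *+ _]mulr_natl.
  by field; rewrite lt0r_neq0.
rewrite form0; apply: contraTT => _; rewrite -ltNge.
apply: mulr_gt0; first exact: divr_gt0.
rewrite (bigD1 a0) //= ltr_pwDl ?sumr_ge0 // => [|a _]; last exact: sqr_ge0.
by rewrite lt_def sqr_ge0 sqrf_eq0 ua0.
Qed.
End PolynomialMethod.

(** * The maximal size of a nearly k-distance set *)

(** Lengths are kept in a list rather than a function on ['I_k], so that they can be
    split into long and short ones. *)
Definition near_dist (R : realType) (ts : seq R) (eps s : R) : bool :=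
  has (fun t => t <= s <= t * (1 + eps)) ts.

Definition near_set (R : realType) (d : nat) (T : finType) (p : T -> 'rV[R]_d)
    (ts : seq R) (eps : R) (S : {set T}) : Prop :=
  {in S &, forall a b, a != b -> near_dist ts eps (edist (p a) (p b))}.

Section UpperBound.
Variable R : realType.
Implicit Types (ts : seq R) (eps K t r : R).

Lemma near_distP ts eps r :
  reflect (exists2 t, t \in ts & t <= r /\ r <= t * (1 + eps))
          (near_dist ts eps r).
Proof.
apply: (iffP hasP) => -[t tts H]; exists t => //; first exact/andP.
exact/andP.
Qed.

(** The factor of the length that is near [r] is at most [3 * eps * t ^ 2]; the other
    factors are bounded crudely, with [r <= 2 * K * t]. *)
Lemma near_dist_prod_small ts eps K r :
  {in ts, forall t, 0 < t} -> 0 <= eps -> eps <= 1 -> 1 <= K ->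
  {in ts &, forall t t', t' <= K * t} -> near_dist ts eps r ->
  `|\prod_(t <- ts) (t ^+ 2 - r ^+ 2)|
    <= 3 * eps * (4 * K ^+ 2) ^+ size ts * \prod_(t <- ts) t ^+ 2.
Proof.
move=> ts0 e0 e1 K1 tsK /near_distP[t0 t0ts [t0r rt0]].
have t00 := ts0 _ t0ts.
have K41 : 1 <= 4 * K ^+ 2 by nra.
rewrite normr_prod !(big_rem t0 t0ts) /= -(prednK (_ : 0 < size ts)%N); last first.
  by case: (ts) t0ts.
rewrite -(size_rem t0ts) [(4 * K ^+ 2) ^+ _]exprS.
have le1 : `|t0 ^+ 2 - r ^+ 2| <= 3 * eps * t0 ^+ 2.
  rewrite distrC subr_sqr ger0_norm; last by apply: mulr_ge0; nra.
  have -> : 3 * eps * t0 ^+ 2 = (t0 * eps) * (3 * t0) by ring.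
  by apply: ler_pM; nra.
have le2 : \prod_(t <- rem t0 ts) `|t ^+ 2 - r ^+ 2|
    <= (4 * K ^+ 2) ^+ size (rem t0 ts) * \prod_(t <- rem t0 ts) t ^+ 2.
  have -> (C : R) s : C ^+ size s = \prod_(t <- s) C.
    by rewrite big_const_seq count_predT iter_mulr_1.
  rewrite -big_split /= big_seq [leRHS]big_seq.
  apply: ler_prod => t /mem_rem tts; rewrite normr_ge0 /=.
  have t_gt0 := ts0 _ tts; have t0K := tsK _ _ tts t0ts.
  have r2 : r <= 2 * (K * t) by nra.
  have r0 : 0 <= r by lra.
  have r4 : r ^+ 2 <= 4 * K ^+ 2 * t ^+ 2 by nra.
  have t2 : 0 <= t ^+ 2 := sqr_ge0 t.
  by rewrite ler_norml; apply/andP; split; nra.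
apply: le_trans (ler_pM _ _ le1 le2) _ => //; first exact: prodr_ge0.
set Q := _ ^+ size _; set P := \prod_(_ <- _) _.
have Q0 : 0 <= Q by apply: exprn_ge0; lra.
have P0 : 0 <= P by apply: prodr_ge0 => t _; exact: sqr_ge0.
rewrite [leLHS](_ : _ = 1 * (3 * eps * t0 ^+ 2 * Q * P)); last by ring.
rewrite [leRHS](_ : _ = (4 * K ^+ 2) * (3 * eps * t0 ^+ 2 * Q * P)); last by ring.
by apply: ler_wpM2r => //; rewrite !mulr_ge0 // ltW.
Qed.

Lemma eps_le1 eps (N Q : R) :
  0 <= eps -> 1 <= N -> 1 <= Q -> N * (3 * eps * Q) < 1 -> eps <= 1.
Proof.
move=> e0 N1 Q1; have e1 : eps * 1 <= eps * Q by rewrite ler_wpM2l.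
have : 1 * (eps * Q) <= N * (eps * Q) by rewrite ler_wpM2r // mulr_ge0 //; lra.
nra.
Qed.

Lemma near_le2 eps t r : 0 < t -> eps <= 1 -> r <= t * (1 + eps) -> r <= 2 * t.
Proof. nra. Qed.

Lemma card_near_set_comparable d (T : finType) (p : T -> 'rV[R]_d) ts eps K
    (S : {set T}) :
  {in ts, forall t, 0 < t} -> 0 <= eps -> 1 <= K ->
  {in ts &, forall t t', t' <= K * t} ->
  (d.+1 ^ size ts).+1%:R * (3 * eps * (4 * K ^+ 2) ^+ size ts) < 1 ->
  near_set p ts eps S -> (#|S| <= d.+1 ^ size ts)%N.
Proof.
move=> ts0 e0 K1 tsK small nearS; rewrite leqNgt; apply/negP => ltS.
have K41 : 1 <= 4 * K ^+ 2 by nra.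
have Q1 : 1 <= (4 * K ^+ 2) ^+ size ts by exact: exprn_ege1.
have N1 : 1 <= (d.+1 ^ size ts).+1%:R :> R by rewrite ler1n.
have e1 := eps_le1 e0 N1 Q1 small.
have /card_geqP[s [us ss sS]] := ltS.
pose s' := Tuple (introT eqP ss); pose q a := p (tnth s' a).
have inj_s : injective (tnth s') by exact/tuple_uniqP.
have [a [b [ab]]] := polynomial_method q ts0 (ltnSn _).
have near_ab : near_dist ts eps (edist (q a) (q b)).
  by apply: nearS; rewrite ?(inj_eq inj_s) // sS // (mem_tnth _ s').
have := near_dist_prod_small ts0 e0 e1 K1 tsK near_ab.
rewrite sqr_edist.
set F := `|_|; set D := \prod_(_ <- _) _ => FD DF.
have D0 : 0 < D.
  by rewrite /D big_seq; apply: prodr_gt0 => t /ts0 t0; exact: exprn_gt0.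
suff : (d.+1 ^ size ts).+1%:R * F
    <= (d.+1 ^ size ts).+1%:R * (3 * eps * (4 * K ^+ 2) ^+ size ts) * D by nra.
by rewrite -mulrA ler_wpM2l.
Qed.

(** Counts of disjoint predicates add up; the boolean sum in the hypothesis encodes
    both disjointness and inclusion in [b]. *)
Lemma leq_count_disjoint (T : Type) (a1 a2 b : pred T) (s : seq T) :
  (forall x, a1 x + a2 x <= b x)%N -> (count a1 s + count a2 s <= count b s)%N.
Proof. by move=> le; elim: s => //= x s IH; have := le x; lia. Qed.

(** Pigeonhole: the [size ts + 1] intervals [[M / 8 ^ (m + 1), M / 8 ^ m)] are
    disjoint, so one of them contains no element of [ts]. *)
Lemma exists_gap ts (M : R) : 0 < M ->
  exists2 m, (m <= size ts)%N &
    {in ts, forall t, t < M / 8 ^+ m -> t < M / 8 ^+ m / 8}.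
Proof.
move=> M0; pose below m t := t < M / 8 ^+ m.
suff [m le_m Hm] : exists2 m, (m <= size ts)%N &
    ~~ has (fun t => below m t && ~~ (t < M / 8 ^+ m / 8)) ts.
  exists m => // t tts lt_t; move/hasPn/(_ t tts): Hm.
  by rewrite /below lt_t negbK.
suff [m] : exists m : 'I_(size ts).+1,
    ~~ has (fun t => below m t && ~~ (t < M / 8 ^+ m / 8)) ts.
  by exists m => //; rewrite -ltnS.
apply/existsP; apply: contraT => /existsPn full.
(* If no interval is empty, passing from [M / 8 ^ m] to [M / 8 ^ (m + 1)] loses
   an element each time, more often than there are elements. *)
have count_below m : (m <= (size ts).+1)%N -> (count (below m) ts + m <= size ts)%N.
  elim: m => [_|m IH lt_m]; first by rewrite addn0 count_size.
  apply: leq_trans (IH (ltnW lt_m)); rewrite addnS -addSn leq_add2r.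
  have := full (Ordinal lt_m); rewrite negbK has_count /= => gap.
  apply: leq_trans (_ : (count (below m.+1) ts + _ <= _)%N).
    by rewrite -addn1 leq_add2l; exact: gap.
  apply: leq_count_disjoint => t; rewrite /below exprSr invfM mulrA.
  have : 0 < M / 8 ^+ m by rewrite divr_gt0 // exprn_gt0.
  set x := M / _ => x0.
  have [lt8|] := ltP t (x / 8); last by case: (t < x).
  by have -> : t < x by lra.
have := count_below _ (leqnn _); lia.
Qed.

Lemma exists_maximum ts : ts != [::] ->
  exists2 M, M \in ts & {in ts, forall t, t <= M}.
Proof.
elim: ts => //= t ts IH _; have [->|/IH[M Mts maxM]] := eqVneq ts [::].
  by exists t => [|s]; rewrite inE // => /eqP->.
have [tM|Mt] := leP t M; [exists M|exists t]; rewrite ?inE ?eqxx ?Mts ?orbT //.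
  by move=> s; rewrite inE => /predU1P[->|/maxM].
by move=> s; rewrite inE => /predU1P[->//|/maxM/le_trans->//]; exact: ltW.
Qed.

Lemma leq_card_bigcup (T I : finType) (A : {set I}) (F : I -> {set T})
    (S : {set T}) n :
  S \subset \bigcup_(i in A) F i -> {in A, forall i, (#|F i| <= n)%N} ->
  (#|S| <= #|A| * n)%N.
Proof.
move=> /subset_leq_card/leq_trans le_S le_F; apply: le_S.
apply: (@leq_trans (\sum_(i in A) #|F i|)); last first.
  by rewrite -sum_nat_const; apply: leq_sum.
elim/big_ind2: _ => [|m1 B1 m2 B2 le1 le2|//]; first by rewrite cards0.
by apply: leq_trans (leq_card_setU _ _) _; exact: leq_add.
Qed.

(** A maximal subset of [S] whose points are pairwise far apart. It serves as a system of
    representatives for the clusters of [S]. *)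
Lemma exists_far_net d (T : finType) (p : T -> 'rV[R]_d) (S : {set T}) (c : R) :
  0 < c ->
  exists M : {set T}, [/\ M \subset S,
    {in M &, forall a b, a != b -> c <= sqdist (p a) (p b)} &
    {in S, forall a, exists2 m, m \in M & sqdist (p a) (p m) < c}].
Proof.
move=> c0.
pose far (M : {set T}) := (M \subset S) &&
  [forall a in M, forall b in M, (a != b) ==> (c <= sqdist (p a) (p b))].
have [|M /maxsetP[/andP[MS farM] maxM]] := @ex_maxset _ far.
  by exists set0; rewrite /far sub0set; apply/forall_inP => a; rewrite inE.
have {}farM : {in M &, forall a b, a != b -> c <= sqdist (p a) (p b)}.
  by move=> a b aM bM; exact/implyP/(forall_inP (forall_inP farM a aM)).
exists M; split=> // a aS; apply/exists_inP; apply: contraT => /exists_inPn aM.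
have {}aM m : m \in M -> c <= sqdist (p a) (p m) by move=> /aM; rewrite -leNgt.
have a_notin : a \notin M by apply/negP => /aM; rewrite sqdistxx leNgt c0.
suff /maxM eqM : far (a |: M).
  by move: a_notin; rewrite -(eqM (subsetUr _ _)) setU11.
rewrite /far subUset sub1set aS MS /=.
apply/forall_inP => x xM; apply/forall_inP => y yM; apply/implyP.
move: xM yM; rewrite !inE => /predU1P[->|xM] /predU1P[->|yM] //.
- by rewrite eqxx.
- by move=> _; exact: aM.
- by move=> _; rewrite sqdistC; exact: aM.
- exact: farM.
Qed.

(** Strong induction on the number of lengths. Take [theta] from [exists_gap], with
    [M] the longest length. If all lengths are at least [theta], they are
    comparable. Otherwise there are long and short lengths. A net of points at
    mutual distance at least [theta] uses only the long ones; the points closer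
    than [theta] to a given net point are actually within [theta / 4] of it, so
    within [theta / 2] of each other, and use only the short ones.

    The smallness of [eps] is stated for [k], not for [size ts], so that it stays
    the same along the induction. *)
Lemma card_near_set d k eps (T : finType) (p : T -> 'rV[R]_d) :
  0 <= eps ->
  (d.+1 ^ k).+1%:R * (3 * eps * (4 * (8 ^+ k) ^+ 2) ^+ k) < 1 ->
  forall ts (S : {set T}), {in ts, forall t, 0 < t} -> (size ts <= k)%N ->
  near_set p ts eps S -> (#|S| <= d.+1 ^ size ts)%N.
Proof.
move=> e0 small ts.
have K1 : 1 <= 8 ^+ k :> R by apply: exprn_ege1; lra.
have K41 : 1 <= 4 * (8 ^+ k) ^+ 2 :> R by nra.
have e1 : eps <= 1.
  by apply: eps_le1 e0 _ _ small; [rewrite ler1n|exact: exprn_ege1].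
have [n] := ubnP (size ts); elim: n ts => // n IH ts lt_n S ts0 le_k nearS.
pose comparable := card_near_set_comparable ts0 e0 K1 _ _ nearS.
have small_ts : (d.+1 ^ size ts).+1%:R *
    (3 * eps * (4 * (8 ^+ k) ^+ 2) ^+ size ts) < 1 :> R.
  apply: le_lt_trans small; apply: ler_pM => //.
  - by rewrite !mulr_ge0 // exprn_ge0 // mulr_ge0 // sqr_ge0.
  - by rewrite ler_nat ltnS leq_pexp2l.
  - apply: ler_wpM2l; first by rewrite mulr_ge0.
    exact: ler_weXn2l.
have [ts_nil|/exists_maximum[M Mts maxM]] := eqVneq ts [::].
  by apply: comparable => // t t'; rewrite ts_nil.
have M0 := ts0 _ Mts.
have [m le_m] := exists_gap ts M0.
set theta := M / 8 ^+ m => gap.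
have m1 : 1 <= 8 ^+ m :> R by apply: exprn_ege1; lra.
have theta0 : 0 < theta by rewrite divr_gt0 // (lt_le_trans _ m1).
have theta_M : theta <= M by rewrite ler_pdivrMr ?(lt_le_trans _ m1) //; nra.
have [/allP all_long|] := boolP (all (fun t => theta <= t) ts).
  apply: comparable => // t t' tts t'ts; apply: le_trans (maxM _ t'ts) _.
  have : M <= 8 ^+ m * t.
    by rewrite mulrC -ler_pdivrMr ?(lt_le_trans _ m1) //; exact: all_long.
  have : 8 ^+ m <= 8 ^+ k :> R by apply: ler_weXn2l; [lra|lia].
  have := ts0 _ tts; nra.
rewrite -has_predC has_count => some_short.
pose long := [seq t <- ts | theta <= t].
pose short := [seq t <- ts | ~~ (theta <= t)].
have some_long : (0 < size long)%N.
  by rewrite size_filter -has_count; apply/hasP; exists M.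
have sz : (size long + size short = size ts)%N by rewrite !size_filter count_predC.
rewrite /= -size_filter -/short in some_short.
have lt_long : (size long < size ts)%N by rewrite -sz -addn1 leq_add2l.
have lt_short : (size short < size ts)%N by rewrite -sz addnC -addn1 leq_add2l.
have [N [NS farN netN]] := exists_far_net p S (exprn_gt0 2 theta0).
rewrite -sz expnD.
(* A near length [t < theta] is at most [theta / 8], so the distance is at most
   [2 * t <= theta / 4]: net points are too far apart for that. *)
have le_N : (#|N| <= d.+1 ^ size long)%N.
  apply: IH.
  - exact: leq_trans lt_long lt_n.
  - by move=> t; rewrite mem_filter => /andP[_ /ts0].
  - exact: leq_trans (ltnW lt_long) le_k.
  move=> a b aN bN ab; apply/near_distP.
  have /near_distP[t tts [tr rt]] :=
    nearS _ _ (subsetP NS _ aN) (subsetP NS _ bN) ab.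
  exists t => //; rewrite mem_filter tts andbT leNgt; apply/negP => t_lt.
  have := farN a b aN bN ab; rewrite -sqr_edist => far_ab.
  have t8 := gap _ tts t_lt; have t0 := ts0 _ tts.
  have r2t := near_le2 t0 e1 rt.
  have : edist (p a) (p b) < theta by lra.
  nra.
apply: leq_trans (leq_mul le_N (leqnn _)).
pose ball m := [set a in S | sqdist (p a) (p m) < theta ^+ 2].
apply: (@leq_card_bigcup _ _ _ ball) => [|c cN].
  apply/subsetP => a aS; have [c cN ac] := netN a aS.
  by apply/bigcupP; exists c; rewrite // inE aS.
have cS := subsetP NS _ cN.
have near_c a : a \in ball c -> sqdist (p a) (p c) <= theta ^+ 2 / 16.
  rewrite inE => /andP[aS]; have [->|ac] := eqVneq a c.
    by rewrite sqdistxx => _; rewrite divr_ge0 // sqr_ge0.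
  have /near_distP[t tts [tr rt]] := nearS _ _ aS cS ac.
  rewrite -sqr_edist => lt_r; have t0 := ts0 _ tts.
  have := gap _ tts; have : edist (p a) (p c) < theta by nra.
  move=> r_lt /(_ (le_lt_trans tr r_lt)) t8.
  have r2t := near_le2 t0 e1 rt.
  have : edist (p a) (p c) <= theta / 4 by lra.
  nra.
apply: IH.
- exact: leq_trans lt_short lt_n.
- by move=> t; rewrite mem_filter => /andP[_ /ts0].
- exact: leq_trans (ltnW lt_short) le_k.
move=> a b a_c b_c ab; apply/near_distP.
have aS : a \in S by move: a_c; rewrite inE => /andP[].
have bS : b \in S by move: b_c; rewrite inE => /andP[].
have /near_distP[t tts [tr rt]] := nearS _ _ aS bS ab.
exists t => //; rewrite mem_filter tts andbT; apply/negP => t_ge.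
have := sqdist_weak_triangle (p a) (p c) (p b).
rewrite -sqr_edist (sqdistC (p c)).
have := near_c _ a_c; have := near_c _ b_c.
nra.
Qed.
End UpperBound.

(** * Turan's theorem *)

Definition edges (V : finType) (e : rel V) : {set {set V}} :=
  [set [set pq.1; pq.2] | pq : V * V & e pq.1 pq.2].

Lemma set2_eq (V : finType) (x y a b : V) :
  x != y -> [set x; y] = [set a; b] -> (x = a /\ y = b) \/ (x = b /\ y = a).
Proof.
move=> xy /setP eq_s; have := eq_s x; have := eq_s y; rewrite !inE !eqxx /= orbT.
move=> /esym/orP[]/eqP ya /esym/orP[]/eqP xa; move: xy; rewrite xa ya ?eqxx //.
  by right.
by left.
Qed.

Section Turan.
Variable V : finType.
Implicit Types (e : rel V) (W S : {set V}) (E : {set {set V}}).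

Lemma edgesP e (s : {set V}) :
  reflect (exists x y, e x y /\ s = [set x; y]) (s \in edges e).
Proof.
apply: (iffP imsetP) => [[[x y]]|[x [y [exy ->]]]].
  by rewrite inE /= => exy ->; exists x, y.
by exists (x, y); rewrite ?inE.
Qed.

(** Each edge [{a, b}] is the image of exactly two ordered pairs. *)
Lemma handshake e : symmetric e -> irreflexive e ->
  (2 * #|edges e| = \sum_x #|[set y | e x y]|)%N.
Proof.
move=> sym irr; pose A := [set pq : V * V | e pq.1 pq.2].
have -> : (\sum_x #|[set y | e x y]| = #|A|)%N.
  rewrite -[RHS]sum1_card; under eq_bigr do rewrite -sum1_card.
  by rewrite pair_big_dep /=; apply: eq_bigl => -[x y]; rewrite !inE.
rewrite -[RHS]sum1_card (partition_big_imset (fun pq => [set pq.1; pq.2])) /=.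
rewrite mulnC -sum_nat_const /edges; apply: eq_bigr => s /imsetP[[a b] /=].
rewrite inE /= => eab ->.
have neq x y : e x y -> x != y by apply: contraTneq => ->; rewrite irr.
have ab := neq _ _ eab.
rewrite sum1_card; transitivity #|[set (a, b); (b, a)]|.
  by rewrite cards2 xpair_eqE negb_and ab.
apply: eq_card => -[x y].
rewrite (_ : _ \in _ = (((x, y) \in A) && ([set x; y] == [set a; b]))) //.
rewrite !inE /= !xpair_eqE; apply/orP/andP => [|[/neq xy /eqP/(set2_eq xy)]].
  by case=> /andP[/eqP-> /eqP->]; rewrite ?[e b a]sym eab // setUC.
by case=> -[-> ->]; [left|right]; rewrite !eqxx.
Qed.

(** Erdos's form of Turan's theorem: some complete [r]-partite graph on [W] majorizes
    [e] degree by degree. Let [v] have maximal degree in [W], and let [N] be its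
    neighbourhood. Cliques of [N] extend by [v], so [N] is colourable with one
    colour less by induction; the last colour goes to all of [W \ N]. A vertex
    outside [N] then gets degree [#|N|], the maximal degree of [e], and a vertex
    of [N] becomes adjacent to all of [W \ N]. *)
Lemma degree_majorization e r W : symmetric e -> irreflexive e ->
  (forall S, S \subset W -> {in S &, forall x y, x != y -> e x y} ->
     (#|S| <= r)%N) ->
  exists2 c : V -> nat, {in W, forall x, (c x < r)%N} &
    {in W, forall x,
      (#|[set y in W | e x y]| <= #|[set y in W | c x != c y]|)%N}.
Proof.
move=> sym irr; elim: r W => [|r IH] W clique_le.
  have noW x : x \in W -> False.
    move=> xW; suff : (#|[set x]| <= 0)%N by rewrite cards1.
    by apply: clique_le => [|a b /set1P-> /set1P->]; rewrite ?sub1set ?eqxx.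
  by exists (fun=> 0%N) => x /noW.
have [->|[v0 v0W]] := set_0Vmem W.
  by exists (fun=> 0%N) => x; rewrite inE.
pose deg x := #|[set y in W | e x y]|.
case: (@arg_maxnP _ v0 (mem W) deg v0W) => v; rewrite inE => vW maxv.
pose N := [set y in W | e v y].
have NW : N \subset W by apply/subsetP => y; rewrite inE => /andP[].
have [S SN cliqueS|c c_lt c_deg] := IH N.
  have vS : v \notin S by apply/negP => /(subsetP SN); rewrite inE irr andbF.
  have := clique_le (v |: S); rewrite cardsU1 vS ltnS; apply.
    by rewrite subUset sub1set vW (subset_trans SN).
  have vS_e y : y \in S -> e v y by move/(subsetP SN); rewrite inE => /andP[].
  move=> x y /setU1P[->|xS] /setU1P[->|yS]; rewrite ?eqxx //.
  - by move=> _; exact: vS_e.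
  - by move=> _; rewrite sym; exact: vS_e.
  - exact: cliqueS.
exists (fun x => if x \in N then c x else r) => x xW.
  by case: ifP => // xN; rewrite ltnS ltnW ?c_lt.
have [xN|xN] := boolP (x \in N); last first.
  apply: leq_trans (maxv x xW) _; apply: subset_leq_card.
  apply/subsetP => y yN; rewrite inE (subsetP NW) //= yN.
  by rewrite neq_ltn c_lt ?orbT.
rewrite -(cardsID N) -[leqRHS](cardsID N); apply: leq_add; last first.
  apply: subset_leq_card; apply/subsetP => y.
  rewrite 2!inE => /andP[yN]; rewrite !inE => /andP[yW _].
  move: (yN); rewrite inE yW /= => /negPf->.
  by rewrite neq_ltn c_lt.
have eqI (a : pred V) : [set y in W | a y] :&: N = [set y in N | a y].
  by apply/setP => y; rewrite !inE; case: (y \in W); rewrite ?andbF //= andbC.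
rewrite !eqI; apply: leq_trans (c_deg x xN) _; apply: subset_leq_card.
by apply/subsetP => y; rewrite !inE; case: ifP; rewrite ?andbF.
Qed.

(** Summing [degree_majorization] over all vertices bounds twice the number of edges, by
    [handshake] for both graphs. *)
Lemma turan_colouring r E :
  simple_graph E -> ~~ has_complete_subgraph r.+1 E ->
  exists2 c : V -> nat, (forall x, (c x < r)%N) &
    (#|E| <= #|edges (fun x y => c x != c y)|)%N.
Proof.
move=> /forall_inP simpleE freeE.
pose e x y := (x != y) && ([set x; y] \in E).
have sym : symmetric e by move=> x y; rewrite /e eq_sym setUC.
have irr : irreflexive e by move=> x; rewrite /e eqxx.
have [S _ cliqueS|c c_lt c_deg] := @degree_majorization e r [set: V] sym irr.
  rewrite leqNgt; apply: contra freeE => /card_geqP[s [us ss sS]].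
  apply/existsP; exists [set x in s].
  rewrite cardsE (card_uniqP us) ss eqxx /=.
  apply/forall_inP => x; rewrite inE => xs; apply/forall_inP => y.
  rewrite inE => ys; apply/implyP => xy.
  by have /andP[] := cliqueS x y (sS _ xs) (sS _ ys) xy.
exists c => [x|]; first exact: c_lt.
apply: leq_trans (_ : #|edges e| <= _)%N.
  apply/subset_leq_card/subsetP => s sE.
  have /cards2P[x [y [xy eq_s]]] := simpleE s sE.
  by apply/edgesP; exists x, y; rewrite /e xy -eq_s.
rewrite -(leq_pmul2l (isT : 0 < 2)%N) !handshake //.
- have inT (a : pred V) : [set y in [set: V] | a y] = [set y | a y].
    by apply/setP => y; rewrite !inE.
  by apply: leq_sum => x _; have := c_deg x (in_setT x); rewrite !inT.
- by move=> x y; rewrite eq_sym.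
- by move=> x; rewrite eqxx.
Qed.
End Turan.

Lemma edge_of_edges (V : finType) (e : rel V) a b :
  symmetric e -> a != b -> [set a; b] \in edges e -> e a b.
Proof.
move=> sym ab /edgesP[x [y [exy /(set2_eq ab)]]].
by case=> -[-> ->] //; rewrite sym.
Qed.

(** The Turan number is defined on ['I_n], so the graph is transported along the
    enumeration of [V]. *)
Lemma edges_le_turan (V : finType) (e : rel V) r :
  symmetric e -> irreflexive e ->
  (forall S : {set V}, {in S &, forall x y, x != y -> e x y} -> (#|S| <= r)%N) ->
  (#|edges e| <= turan_number r.+1 #|V|)%N.
Proof.
move=> sym irr clique_le; pose f : V -> 'I_#|V| := enum_rank.
have f_inj : injective f by exact: enum_rank_inj.
have f_pair a b : f @: [set a; b] = [set f a; f b].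
  by rewrite imsetU1 imset_set1.
rewrite -(card_imset _ (imset_inj f_inj)).
apply: (@leq_bigmax_cond _ _ (fun E : {set {set 'I_#|V|}} => #|E|)).
apply/andP; split.
  apply/forall_inP => _ /imsetP[s /edgesP[x [y [exy ->]]] ->].
  rewrite f_pair cards2 (inj_eq f_inj) eqSS eqb1.
  by apply: contraTneq exy => ->; rewrite irr.
apply/negP => /existsP[S /andP[/eqP cardS cliqueS]].
suff /clique_le : {in f @^-1: S &, forall x y, x != y -> e x y}.
  rewrite on_card_preimset ?cardS ?ltnn //; exact/onW_bij/enum_rank_bij.
move=> x y; rewrite !inE => xS yS xy; apply: edge_of_edges => //.
have /imsetP[s s_e eq_s] : [set f x; f y] \in [set f @: (s : {set V}) | s in edges e].
  apply: (implyP (forall_inP (forall_inP cliqueS _ xS) _ yS)).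
  by rewrite (inj_eq f_inj).
by rewrite (_ : [set x; y] = s) //; apply: (imset_inj f_inj); rewrite f_pair.
Qed.

Lemma leq_edges (V V' : finType) (e : rel V) (e' : rel V') (f : V -> V') :
  injective f -> (forall x y, e x y -> e' (f x) (f y)) ->
  (#|edges e| <= #|edges e'|)%N.
Proof.
move=> f_inj e_e'; rewrite -(card_imset _ (imset_inj f_inj)).
apply/subset_leq_card/subsetP => _ /imsetP[s /edgesP[x [y [exy ->]]] ->].
by apply/edgesP; exists (f x), (f y); rewrite imsetU1 imset_set1 e_e'.
Qed.

(** * Nested simplices *)

Section NestedSimplices.
Variables (R : realType) (d : nat).

(** The [d] scaled unit vectors are at equal distances; a vector with all entries [a],
    scaled alike, has that distance from each of them when
    [d * a ^ 2 = 2 * a + 1]. *)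
Lemma exists_regular_simplex (L : R) : (0 < d)%N -> 0 < L ->
  exists v : 'I_d.+1 -> 'rV[R]_d, forall i j, i != j -> sqdist (v i) (v j) = L.
Proof.
move=> d_gt0 L0; set s := Num.sqrt (L / 2).
have s2 : s ^+ 2 = L / 2 by rewrite sqr_sqrtr // divr_ge0 // ltW.
have d0 : d%:R != 0 :> R by rewrite pnatr_eq0 -lt0n.
pose a : R := (1 + Num.sqrt d.+1%:R) / d%:R.
have a2 : d%:R * a ^+ 2 = 2 * a + 1.
  have : Num.sqrt d.+1%:R ^+ 2 = d%:R + 1 :> R.
    by rewrite sqr_sqrtr ?ler0n // -natr1.
  rewrite /a; set q := Num.sqrt _ => q2.
  have -> : d%:R * ((1 + q) / d%:R) ^+ 2 = (1 + 2 * q + q ^+ 2) / d%:R.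
    by field.
  by rewrite q2; field.
pose v (i : 'I_d.+1) : 'rV[R]_d :=
  if unlift ord0 i is Some j then s *: delta_mx 0 j else const_mx (s * a).
have delta_sum j : \sum_(i < d) (i == j)%:R = 1 :> R.
  by rewrite (bigD1 j) //= eqxx big1 ?addr0 // => i /negPf->.
have vv (j j' : 'I_d) : j != j' ->
    sqdist (s *: delta_mx 0 j) (s *: delta_mx 0 j' : 'rV_d) = L.
  move=> jj'; transitivity (\sum_(i < d) s ^+ 2 * ((i == j)%:R + (i == j')%:R)).
    apply: eq_bigr => i _; rewrite !mxE /=.
    have [->|_] := eqVneq i j; first by rewrite (negPf jj') /=; ring.
    by case: (i == j') => /=; ring.
  by rewrite -mulr_sumr big_split /= !delta_sum s2; field.
have v0 (j : 'I_d) : sqdist (const_mx (s * a)) (s *: delta_mx 0 j : 'rV_d) = L.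
  transitivity (\sum_(i < d) s ^+ 2 * (a ^+ 2 + (1 - 2 * a) * (i == j)%:R)).
    by apply: eq_bigr => i _; rewrite !mxE /=; case: (i == j) => /=; ring.
  rewrite -mulr_sumr big_split /= sumr_const card_ord.
  rewrite -[X in _ + X]mulr_sumr delta_sum.
  by rewrite -[a ^+ 2 *+ _]mulr_natl a2 s2; field.
exists v => i j; rewrite /v.
case: unliftP => [i'|] ->; case: unliftP => [j'|] -> //.
- by rewrite (inj_eq lift_inj); exact: vv.
- by rewrite sqdistC v0.
Qed.

Lemma sqdist_scaled_shift (w p q : 'rV[R]_d) (delta : R) :
  sqdist (w + delta *: p) (w + delta *: q) = delta ^+ 2 * sqdist p q.
Proof.
by rewrite /sqdist mulr_sumr; apply: eq_bigr => i _; rewrite !mxE; ring.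
Qed.

Lemma edist_scaled_shift (w p q : 'rV[R]_d) (delta : R) : 0 <= delta ->
  edist (w + delta *: p) (w + delta *: q) = delta * edist p q.
Proof.
move=> delta0; rewrite /edist -!/(sqdist _ _) sqdist_scaled_shift.
by rewrite sqrtrM ?sqr_ge0 // sqrtr_sqr ger0_norm.
Qed.

(** A Lipschitz constant at 0, valid up to [delta = 1], of the function
    [delta |-> sqdist (v + delta * p) (w + delta * q)]. *)
Definition perturbation_bound (v w p q : 'rV[R]_d) : R :=
  \sum_(i < d) (2 * `|v 0 i - w 0 i| * `|p 0 i - q 0 i|
                + (p 0 i - q 0 i) ^+ 2).

Lemma perturbation_bound_ge0 v w p q : 0 <= perturbation_bound v w p q.
Proof.
by apply: sumr_ge0 => i _; rewrite addr_ge0 ?sqr_ge0 // !mulr_ge0.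
Qed.

Lemma sqdist_perturbation v w p q (delta : R) : 0 <= delta -> delta <= 1 ->
  `|sqdist (v + delta *: p) (w + delta *: q) - sqdist v w|
    <= delta * perturbation_bound v w p q.
Proof.
move=> delta0 delta1; rewrite /sqdist -sumrB mulr_sumr.
apply: le_trans (ler_norm_sum _ _ _) _; apply: ler_sum => i _; rewrite !mxE.
set x := v 0 i - w 0 i; set y := p 0 i - q 0 i.
rewrite (_ : _ - _ = delta * (2 * x * y + delta * y ^+ 2)); last first.
  by rewrite /x /y; ring.
rewrite normrM ger0_norm // ler_wpM2l //.
apply: le_trans (ler_normD _ _) _.
rewrite (normrM (2 * x)) (normrM 2) (normrM delta) normr_nat.
rewrite (ger0_norm (sqr_ge0 y)) (ger0_norm delta0) lerD2l.
by rewrite ler_piMl // sqr_ge0.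
Qed.

(** The colour [c x] of [x] is read as a string of [k] digits: digit [j] selects a vertex
    in the simplex of level [j], so the first digit where [x] and [y] differ
    decides which length their distance is near to. The induction adds a level
    on the outside: copies of a given configuration, shrunk by a small [delta],
    are put at the vertices of a large simplex. *)
Lemma nested_simplices (V : finType) (eps : R) k (c : V -> nat -> 'I_d.+1) :
  (0 < d)%N -> 0 < eps ->
  exists (p : V -> 'rV[R]_d) (t : nat -> R),
    [/\ injective p, forall j, 0 < t j &
      forall x y j, (j < k)%N -> (forall i, (i < j)%N -> c x i = c y i) ->
        c x j != c y j ->
        t j <= edist (p x) (p y) /\ edist (p x) (p y) <= t j * (1 + eps)].
Proof.
move=> d_gt0 eps0; elim: k c => [|k IH] c.
  (* With no digits all that remains is to keep the points distinct. *)
  exists (fun x => const_mx (enum_rank x)%:R), (fun=> 1); split=> // x y.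
  move/matrixP/(_ 0 (Ordinal d_gt0)); rewrite !mxE => /eqP.
  by rewrite eqr_nat => /eqP/val_inj/enum_rank_inj.
have [p [t [p_inj t0 pt]]] := IH (fun x j => c x j.+1).
(* The squared side [1 + eps] lies between [1 ^ 2] and [(1 + eps) ^ 2], with room
   [eps] for perturbation on either side. *)
have [v v_dist] := exists_regular_simplex d_gt0 (ltr_wpDl ler01 eps0 : 0 < 1 + eps).
pose B x y := perturbation_bound (v (c x 0)) (v (c y 0)) (p x) (p y).
pose C := \sum_x \sum_y B x y.
have B0 x y : 0 <= B x y by exact: perturbation_bound_ge0.
have B_C x y : B x y <= C.
  rewrite /C (bigD1 x) //= (bigD1 y) //= -addrA lerDl addr_ge0 ?sumr_ge0 //.
  by move=> i _; rewrite sumr_ge0.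
have C0 : 0 <= C by apply: sumr_ge0 => x _; apply: sumr_ge0.
have Ceps : 0 < C + eps by rewrite ltr_wpDl.
pose delta := eps / (C + eps).
have delta0 : 0 < delta by rewrite divr_gt0.
have delta1 : delta <= 1 by rewrite ler_pdivrMr // mul1r lerDr.
have deltaC : delta * C <= eps.
  by rewrite mulrAC ler_pdivrMr // ler_wpM2l ?lerDl // ltW.
pose P x := v (c x 0) + delta *: p x.
have P0 x y : c x 0 != c y 0 ->
    1 <= edist (P x) (P y) /\ edist (P x) (P y) <= 1 * (1 + eps).
  move=> cxy; have r0 : 0 <= edist (P x) (P y) by exact: sqrtr_ge0.
  have := sqdist_perturbation (v (c x 0)) (v (c y 0)) (p x) (p y)
    (ltW delta0) delta1.
  rewrite -/(P x) -/(P y) -/(B x y) v_dist // -sqr_edist.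
  have : delta * B x y <= delta * C by rewrite ler_wpM2l // ltW.
  move=> le1 /le_trans/(_ (le_trans le1 deltaC)).
  by rewrite ler_norml => /andP[lo hi]; split; nra.
have PS x y : c x 0 = c y 0 ->
    edist (P x) (P y) = delta * edist (p x) (p y).
  by move=> cxy; rewrite /P cxy edist_scaled_shift // ltW.
exists P, (fun j => if j is j'.+1 then delta * t j' else 1); split.
- move=> x y eqP; have [cxy|/P0[]] := eqVneq (c x 0) (c y 0); last first.
    rewrite eqP /edist big1 ?sqrtr0 ?ler10 // => i _.
    by rewrite subrr expr0n.
  apply: p_inj; move: eqP; rewrite /P cxy => /addrI/scalerI; apply.
  by rewrite gt_eqF.
- by case=> // j; rewrite mulr_gt0.
- move=> x y [|j] lt_j eq_c neq_c; first exact: P0.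
  have [|lo hi] := pt x y j lt_j _ neq_c.
    by move=> i lt_i; exact: eq_c i.+1 lt_i.
  by rewrite PS ?eq_c // -mulrA !ler_pM2l.
Qed.
End NestedSimplices.

(** * Near pairs of finite point sets *)

Lemma in_intervalsE (R : realType) k (t : 'I_k -> R) eps s :
  in_intervals t eps s = near_dist (codom t) eps s.
Proof.
apply/existsP/hasP => [[j]|[_ /codomP[j ->]]]; rewrite ?in_itv /=.
  by exists (t j); rewrite ?codom_f.
by exists j; rewrite in_itv.
Qed.

Lemma edistC (R : realType) d (x y : 'rV[R]_d) : edist x y = edist y x.
Proof. by rewrite /edist -!/(sqdist _ _) sqdistC. Qed.

(** Colours below [(d + 1) ^ k] are turned into [k] digits by enumerating the functions
    from ['I_k] to ['I_d.+1]. *)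
Lemma coloured_configuration (R : realType) d k (V : finType) (c : V -> nat)
    (eps : R) :
  (0 < d)%N -> 0 < eps -> (forall x, c x < d.+1 ^ k)%N ->
  exists (p : V -> 'rV[R]_d) (t : 'I_k -> R),
    [/\ injective p, forall j, 0 < t j &
      forall x y, c x != c y -> in_intervals t eps (edist (p x) (p y))].
Proof.
move=> d0 eps0 c_lt; pose T := {ffun 'I_k -> 'I_d.+1}.
pose w x : T := nth [ffun=> ord0] (enum T) (c x).
pose digit x j := oapp (w x) ord0 (insub j).
have [p [t [p_inj t0 pt]]] := nested_simplices k digit d0 eps0.
exists p, (fun j => t j); split=> // x y cxy.
have size_T : size (enum T) = (d.+1 ^ k)%N.
  by rewrite -cardE card_ffun !card_ord.
have w_neq : w x != w y by rewrite nth_uniq ?size_T ?c_lt ?enum_uniq.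
have [j wj] : exists j, w x j != w y j.
  apply/existsP; apply: contraNT w_neq => /existsPn eq_w.
  by apply/eqP/ffunP => j; apply/eqP; rewrite -[_ == _]negbK.
have ex_j : exists j, digit x j != digit y j.
  by exists j; rewrite /digit valK.
case: (ex_minnP ex_j) => i neq_i min_i.
have lt_i : (i < k)%N.
  by apply: leq_ltn_trans (ltn_ord j); apply: min_i; rewrite /digit valK.
have [|lo hi] := pt x y i lt_i _ neq_i.
  move=> i' lt_i'; apply/eqP; apply: contraTT lt_i' => /min_i.
  by rewrite -leqNgt.
by apply/existsP; exists (Ordinal lt_i); rewrite in_itv /= lo hi.
Qed.

(** The set [edges (near_rel t eps)] is convertible to [near_pairs P t eps]. *)
Definition near_rel (R : realType) d k (P : {fset 'rV[R]_d}) (t : 'I_k -> R)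
    (eps : R) : rel P :=
  fun a b => (a != b) && in_intervals t eps (edist (val a) (val b)).

Lemma card_near_intervals (R : realType) d k (eps : R) (P : {fset 'rV[R]_d})
    (t : 'I_k -> R) (S : {set P}) :
  0 <= eps -> (d.+1 ^ k).+1%:R * (3 * eps * (4 * (8 ^+ k) ^+ 2) ^+ k) < 1 ->
  (forall j, 0 < t j) ->
  {in S &, forall a b, a != b -> in_intervals t eps (edist (val a) (val b))} ->
  (#|S| <= d.+1 ^ k)%N.
Proof.
move=> e0 small t0 nearS.
have sz : size (codom t) = k by rewrite size_codom card_ord.
rewrite -[k in leqRHS]sz; apply: (card_near_set (p := val) e0 small).
- by move=> _ /codomP[j ->].
- by rewrite sz.
- by move=> a b aS bS ab; rewrite -in_intervalsE nearS.
Qed.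

Theorem theorem2 (R : realType) :
  (forall d k : nat, (1 <= d)%N -> (1 <= k)%N ->
     exists eps0 : R, 0 < eps0 /\
       forall eps : R, 0 < eps -> eps < eps0 ->
         max_dist_set_card d k eps ((d.+1 ^ k)%N) /\
         (forall (n : nat) (P : {fset 'rV[R]_d}) (t : 'I_k -> R),
            (1 <= n)%N -> #|` P| = n -> (forall j, 0 < t j) ->
            (#|near_pairs P t eps| <= turan_number ((d.+1 ^ k).+1) n)%N)) /\
  (forall (d k n : nat) (eps : R),
     (1 <= d)%N -> (1 <= k)%N -> (1 <= n)%N -> 0 < eps ->
     exists (P : {fset 'rV[R]_d}) (t : 'I_k -> R),
       #|` P| = n /\ (forall j, 0 < t j) /\
       (turan_number ((d.+1 ^ k).+1) n <= #|near_pairs P t eps|)%N).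
Proof.
split=> [d k d0 _|d k n eps d0 _ n0 eps0].
  pose Q : R := 3 * (d.+1 ^ k).+1%:R * (4 * (8 ^+ k) ^+ 2) ^+ k.
  have Q0 : 0 < Q by rewrite !mulr_gt0 ?exprn_gt0 ?mulr_gt0 ?exprn_gt0 ?ltr0n.
  exists Q^-1; split=> [|eps eps0 lt_eps]; first by rewrite invr_gt0.
  have small : (d.+1 ^ k).+1%:R * (3 * eps * (4 * (8 ^+ k) ^+ 2) ^+ k) < 1 :> R.
    rewrite [ltLHS](_ : _ = eps * Q); last by rewrite /Q; ring.
    by rewrite -ltr_pdivlMr // mul1r.
  split.
    (* Giving all points different colours yields the extremal distance set. *)
    split=> [|_ [P [[t [t0 tP]] <-]]].
      have [p [t [p_inj t0 pt]]] :=
        coloured_configuration d0 eps0 (fun x : 'I_(d.+1 ^ k) => ltn_ord x).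
      exists [fset p x | x in 'I_(d.+1 ^ k)]%fset; split; last first.
        by rewrite card_imfset //= size_enum_ord.
      exists t; split=> // _ _ /imfsetP[x _ ->] /imfsetP[y _ ->] pxy.
      by apply: pt; apply: contra_neq pxy => /val_inj ->.
    rewrite cardfE -cardsT.
    apply: card_near_intervals (ltW eps0) small t0 _ => a b _ _ ab.
    by apply: tP; rewrite ?fsvalP // (inj_eq val_inj).
  move=> n P t _ <- t0; rewrite cardfE.
  apply: (@edges_le_turan _ (near_rel t eps)).
  - by move=> a b; rewrite /near_rel eq_sym edistC.
  - by move=> a; rewrite /near_rel eqxx.
  - move=> S cliqueS; apply: card_near_intervals (ltW eps0) small t0 _.
    by move=> a b aS bS /(cliqueS _ _ aS bS)/andP[].
(* The point set must suit a single extremal graph; the maximum is attained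
   because the edgeless graph qualifies, [(d + 1) ^ k + 1] being at least 2. *)
have [E /andP[simpleE freeE] ->] : {E : {set {set 'I_n}} |
    simple_graph E && ~~ has_complete_subgraph (d.+1 ^ k).+1 E &
    turan_number (d.+1 ^ k).+1 n = #|E|}.
  apply: eq_bigmax_cond.
  apply/card_gt0P; exists set0; apply/andP; split.
    by apply/forall_inP => e; rewrite inE.
  apply/negP => /existsP[S /andP[/eqP cardS cliqueS]].
  have /card_gt1P[x [y [xS yS xy]]] : (1 < #|S|)%N by rewrite cardS ltnS expn_gt0.
  have := implyP (forall_inP (forall_inP cliqueS x xS) y yS) xy.
  by rewrite inE.
have [c c_lt /leq_trans le_c] := turan_colouring simpleE freeE.
have [p [t [p_inj t0 pt]]] := coloured_configuration d0 eps0 c_lt.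
exists [fset p x | x in 'I_n]%fset, t; split.
  by rewrite card_imfset //= size_enum_ord.
split=> //; apply: le_c.
have pP x : p x \in [fset p x | x in 'I_n]%fset by apply: in_imfset.
apply: (@leq_edges _ _ _ (near_rel t eps) (fun x => [` pP x]%fset)).
  by move=> x y /(congr1 val)/p_inj.
move=> x y cxy; rewrite /near_rel pt // andbT.
by apply: contra_neq cxy => /(congr1 val)/p_inj->.
Qed.
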